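(* Let $n\ge2$ and let $G_j=(V_j,E_j)$, $1\le j\le n$, be connected graphs with pairwise disjoint vertex sets. Suppose that all $n$ graph Laplacians $L_j$ share a common eigenvalue $\lambda>0$, with corresponding (real-valued) eigenvectors $\varphi_{(j)}$, and that $i_0(\varphi_{(j)})\ne\emptyset$ for all $j$. Let $G=\left(\bigcup_{j=1}^nV_j,\ \bigcup_{j=1}^nE_j\cup E_0\right)$, where $E_0=\{(x_i,y_i)\}_{i=1}^K$ is a nonempty set of edges such that each edge satisfies $x_i\in i_0(\varphi_{(j)})$ and $y_i\in i_0(\varphi_{(\ell)})$ for some $j\neq\ell$. Define $\varphi$ on $G$ by $\varphi(x)=\varphi_{(j)}(x)$ for $x\in V_j$. Then $\lambda$ is an eigenvalue of (the Laplacian of) $G$ and $\varphi$ is a corresponding eigenvector. Furthermore, if in addition the common eigenvalue $\lambda>0$ is the algebraic connectivity, i.e. the lowest nonzero Laplacian eigenvalue, of each of the graphs $G_j$, then $\lambda$ is an eigenvalue of $G$ but not the smallest positive eigenvalue of $G$; hence $\varphi$ is an eigenvector of $G$ but not its Fiedler vector.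
   Context: All graphs are finite, undirected, unweighted and simple. The Laplacian of a graph is $Lf(x)=\sum_{y\sim x}(f(x)-f(y))$; eigenvalues and eigenvectors of a graph mean those of its Laplacian. For a function $f$ on a vertex set, $i_0(f)$ is the set of vertices $x$ with $f(x)=0$. The eigenvalues of $G$ are ordered $0=\lambda_0\le\lambda_1\le\cdots$; a Fiedler vector is an eigenvector associated with $\lambda_1$, which for a connected graph is the smallest positive eigenvalue (the algebraic connectivity). *)

(* Defs.v *)
From HB Require Import structures.
From mathcomp Require Import all_boot all_order all_algebra.
From mathcomp Require Import reals polyrcf.

Set Implicit Arguments.
Unset Strict Implicit.
Unset Printing Implicit Defensive.

Import Order.TTheory GRing.Theory Num.Theory.
Local Open Scope ring_scope.

Definition simple_graph (V : finType) (e : rel V) : Prop :=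
  symmetric e /\ irreflexive e.

Definition connected_graph (V : finType) (e : rel V) : Prop :=
  forall x y : V, connect e x y.

Section Spectrum.
Context (R : realType) (V : finType).
Implicit Types (e : rel V) (f : V -> R) (a b : R).

Definition laplacian e f (x : V) : R := \sum_(y | e x y) (f x - f y).

Definition zero_set f : {set V} := [set x | f x == 0].

Definition eigenvector e a f : Prop :=
  (exists x, f x != 0) /\ (forall x, laplacian e f x = a * f x).

Definition graph_eigenvalue e a : Prop := exists f, eigenvector e a f.

Definition smallest_positive_eigenvalue e a : Prop :=
  [/\ graph_eigenvalue e a, 0 < a
    & forall b, graph_eigenvalue e b -> 0 < b -> a <= b].

(* Row i is the image of the indicator function of the i-th vertex, so that the
   matrix acts on row vectors from the right, as in [eigenvalue]. *)
Definition laplacian_mx e : 'M[R]_#|V| :=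
  \matrix_(i, j) laplacian e (fun y => (y == enum_val i)%:R) (enum_val j).

(* Nondecreasing list of the eigenvalues, repeated according to multiplicity:
   [rootsR] lists the distinct real roots in increasing order. *)
Definition spectrum e : seq R :=
  let p := char_poly (laplacian_mx e) in
  flatten [seq nseq (mup a p) a | a <- rootsR p].

Definition fiedler_vector e f : Prop := eigenvector e (spectrum e)`_1 f.

Lemma mul_laplacian_mx e f :
  (\row_i f (enum_val i)) *m laplacian_mx e
    = \row_j laplacian e f (enum_val j).
Proof.
apply/rowP => j; rewrite !mxE.
under eq_bigr => i _ do rewrite !mxE /laplacian mulr_sumr.
rewrite exchange_big /=; apply: eq_bigr => y _.
have H z : \sum_(i < #|V|) f (enum_val i) * (z == enum_val i)%:R = f z.
  rewrite (bigD1 (enum_rank z)) //= enum_rankK eqxx mulr1 big1 ?addr0 // => i.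
  by apply: contraNeq; rewrite mulf_eq0 pnatr_eq0 eqb0 negb_or negbK
    => /andP[_ /eqP->]; rewrite enum_valK.
under eq_bigr => i _ do rewrite mulrBr.
by rewrite sumrB !H.
Qed.

Lemma graph_eigenvalueE e a :
  graph_eigenvalue e a <-> eigenvalue (laplacian_mx e) a.
Proof.
split=> [[f [[x fx] Lf]]|/eigenvalueP[v vL v0]].
  apply/eigenvalueP; exists (\row_i f (enum_val i)).
    by rewrite mul_laplacian_mx; apply/rowP => j; rewrite !mxE Lf.
  apply: contraNneq fx => /rowP/(_ (enum_rank x)).
  by rewrite !mxE enum_rankK => ->.
pose f x := v 0 (enum_rank x).
have vE : v = \row_i f (enum_val i).
  by apply/rowP => i; rewrite mxE /f enum_valK.
exists f; split=> [|x].
  by have /rV0Pn[i vi] := v0; exists (enum_val i); rewrite /f enum_valK.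
move: vL; rewrite {1}vE mul_laplacian_mx => /rowP/(_ (enum_rank x)).
by rewrite !mxE enum_rankK.
Qed.

Lemma mem_spectrum e a : a \in spectrum e <-> graph_eigenvalue e a.
Proof.
rewrite graph_eigenvalueE eigenvalue_root_char /spectrum.
set p := char_poly _.
have p0 : p != 0 by rewrite monic_neq0 ?char_poly_monic.
have rP b : (b \in rootsR p) = root p b by rewrite -roots_on_rootsR // in_itv.
split=> [/flatten_mapP[b bp]|ra].
  by rewrite mem_nseq => /andP[_ /eqP->]; rewrite -rP.
apply/flatten_mapP; exists a; first by rewrite rP.
by rewrite mem_nseq eqxx andbT -XsubC_dvd // -root_factor_theorem.
Qed.

Lemma spectrum_sorted e : sorted <=%R (spectrum e).
Proof.
rewrite /spectrum; set p := char_poly _.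
have : sorted <%R (rootsR p) by exact: sorted_roots.
elim: (rootsR p) => //= b s IH; rewrite path_sortedE; last exact: lt_trans.
case/andP=> /allP bs /IH ss.
elim: (mup b p) => //= k; set t := _ ++ _ => st.
rewrite path_sortedE; last exact: le_trans.
rewrite {}st andbT; apply/allP => c.
rewrite mem_cat mem_nseq => /orP[/andP[_ /eqP->]//|/flatten_mapP[d /bs bd]].
by rewrite mem_nseq => /andP[_ /eqP->]; exact: ltW.
Qed.

End Spectrum.

Section Join.
Context (n : nat) (V : 'I_n -> finType).

(* The vertices of G are the tagged elements of the V j, whose vertex sets are
   thereby disjoint; an unordered edge is given by either of its orientations. *)
Definition join_graph (e : forall j, rel (V j))
    (E0 : {set {j : 'I_n & V j} * {j : 'I_n & V j}}) :
    rel {j : 'I_n & V j} :=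
  fun u v => [|| (tag u == tag v) && e (tag u) (tagged u) (tagged_as u v),
                 (u, v) \in E0 | (v, u) \in E0].

Lemma join_graph_simple (e : forall j, rel (V j))
    (E0 : {set {j : 'I_n & V j} * {j : 'I_n & V j}}) :
  (forall j, simple_graph (e j)) ->
  (forall x y, (x, y) \in E0 -> tag x != tag y) ->
  simple_graph (join_graph e E0).
Proof.
move=> se sE; split=> [[i u] [j v]|[i u]]; rewrite /join_graph /=; last first.
  rewrite eqxx tagged_asE (se i).2 /= orbb.
  by apply/negP => /sE /=; rewrite eqxx.
case: (eqVneq i j) v => [<-|ij] v /=.
  by rewrite !tagged_asE (se i).1; congr orb; exact: orbC.
by rewrite orbC.
Qed.

Definition join_fun (T : Type) (f : forall j, V j -> T)
  (u : {j : 'I_n & V j}) : T := f (tag u) (tagged u).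

End Join.

(* Main.v *)
Require Import Defs.
From HB Require Import structures.
From mathcomp Require Import all_boot all_order all_algebra.
From mathcomp Require Import ring spectral complex.
From mathcomp Require Import reals.

Set Implicit Arguments.
Unset Strict Implicit.
Unset Printing Implicit Defensive.

Import Order.TTheory GRing.Theory Num.Theory.
Local Open Scope ring_scope.

(** Every added edge joins two zeros of [phi], so it contributes nothing to the
    Laplacian of [phi]: this gives the first half.

    The second half is a variational argument.  Let an added edge join the
    parts j and l, and let g be a combination of the positive parts of phi_j
    and phi_l, extended by zero, with coefficients alpha > 0 and - beta < 0
    such that g sums to zero over the union of the two parts.  The added edge
    and the connectedness of the parts put this union in a single component of
    G, so g is orthogonal to every harmonic function of G, even when G is
    disconnected.  At a vertex where phi is positive no added edge occurs, and
    cutting off the negative values of phi only raises its neighbours' values;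
    hence the Rayleigh quotient of g is at most lambda
    ([positive_part_subsolution]).

    If G had no eigenvalue strictly between 0 and lambda, the spectral theorem
    would force g to be an eigenvector for lambda ([rayleigh_minimizer]).  But
    on part j, g is nonnegative and vanishes somewhere, and at a zero of such an
    eigenvector all neighbours must vanish ([eigenfunction_zero_spreads]); by
    connectedness g would vanish on all of part j, although phi_j takes positive
    values because it is nonzero and sums to zero.  So G has an eigenvalue
    strictly between 0 and lambda, and the second entry of its spectrum is
    smaller than lambda ([spectrum1_lt]). *)

(** * Rayleigh quotients of symmetric matrices *)

(** The condition [v <= A] says that v is orthogonal to the kernel of the
    symmetric matrix A.  In an orthonormal eigenbasis with eigenvalues x_i and
    coordinates c_i of v, the bound on the quotient reads
    sum_i (x_i - lambda) |c_i|^2 <= 0; as c_i = 0 when x_i = 0, all terms are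
    nonnegative, so all vanish.  The eigenbasis is taken over [R[i]], where
    hermitian matrices are unitarily diagonalizable. *)
Lemma rayleigh_minimizer_eigenvector (R : rcfType) (n : nat) (A : 'M[R]_n)
    (lambda : R) (v : 'rV[R]_n) :
  A^T = A ->
  (forall a, eigenvalue A a -> a = 0 \/ lambda <= a) ->
  (v <= A)%MS ->
  (v *m A *m v^T) 0 0 <= lambda * (v *m v^T) 0 0 ->
  v *m A = lambda *: v.
Proof.
move=> symA specA /submxP[w vE] vle.
pose toC : {rmorphism R -> R[i]} := real_complex R.
pose AC := map_mx toC A; pose vC := map_mx toC v.
have trC_map m p (B : 'M[R]_(m, p)) :
    map_mx Num.conj (map_mx toC B)^T = map_mx toC B^T.
  apply/matrixP => i j; rewrite !mxE; apply/CrealP/complex_realP.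
  by exists (B j i).
have hermA : AC \is hermsymmx.
  by apply/is_hermitianmxP; rewrite expr0 scale1r trC_map symA.
have /hermitian_normalmx/orthomx_spectralP := hermA.
set P := spectralmx AC; set d := spectral_diag AC => ACE.
have unitP : P \is unitarymx by exact: spectral_unitarymx.
rewrite (invmx_unitary unitP) in ACE; set Pt := (P ^t*)%sesqui in ACE.
have PPt : P *m Pt = 1%:M by exact/unitarymxP.
have PtP : Pt *m P = 1%:M by exact: mulmx1C.
pose x i : R := complex.Re (d 0 i).
have dE i : d 0 i = toC (x i).
  by apply/esym/RRe_real; apply/mxOverP/hermitian_spectral_diag_real.
have PAC : P *m AC = diag_mx d *m P by rewrite ACE !mulmxA PPt mul1mx.
have specx i : x i = 0 \/ lambda <= x i.
  (* The i-th row of P is an eigenvector; the eigenvalue is real, so it is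
     already an eigenvalue of A over R. *)
  apply: specA; rewrite -(eigenvalue_map toC) -dE; apply/eigenvalueP.
  exists (row i P).
    by rewrite -row_mul PAC mul_diag_mx; apply/rowP => j; rewrite !mxE.
  apply/eqP => /(congr1 (mulmx^~ Pt)); rewrite -row_mul PPt mul0mx.
  by move/rowP/(_ i)/eqP; rewrite !mxE eqxx oner_eq0.
pose c := vC *m Pt.
have vCE : vC = c *m P by rewrite /c -mulmxA PtP mulmx1.
(* As v = w A, the i-th coordinate of v carries a factor x i. *)
pose u := map_mx toC w *m Pt.
have cE i : c 0 i = u 0 i * toC (x i).
  rewrite /c /vC vE map_mxM -/AC ACE !mulmxA -/u -[_ *m P *m Pt]mulmxA PPt.
  by rewrite mulmx1 mul_mx_diag mxE dE.
clearbody c u.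
have vCt : map_mx toC v^T = Pt *m (c ^t*)%sesqui.
  by rewrite -trC_map -/vC vCE trmx_mul map_mxM.
have normE : toC ((v *m v^T) 0 0) = \sum_i `|c 0 i| ^+ 2.
  transitivity ((c *m (c ^t*)%sesqui) 0 0).
    transitivity ((map_mx toC (v *m v^T)) 0 0); first by rewrite [RHS]mxE.
    by rewrite map_mxM vCt -/vC vCE mulmxA -[c *m P *m Pt]mulmxA PPt mulmx1.
  by rewrite mxE; apply: eq_bigr => i _; rewrite !mxE normCK.
have energyE : toC ((v *m A *m v^T) 0 0) = \sum_i toC (x i) * `|c 0 i| ^+ 2.
  transitivity ((c *m diag_mx d *m (c ^t*)%sesqui) 0 0).
    transitivity ((map_mx toC (v *m A *m v^T)) 0 0); first by rewrite [RHS]mxE.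
    rewrite !map_mxM vCt -/vC vCE -/AC -(mulmxA c P) PAC !mulmxA.
    by rewrite -(mulmxA _ P Pt) PPt mulmx1.
  rewrite mul_mx_diag mxE; apply: eq_bigr => i _.
  by rewrite !mxE dE normCK mulrCA mulrA.
have term_ge0 i : 0 <= toC (x i - lambda) * `|c 0 i| ^+ 2.
  case: (specx i) => [xi0|lex].
    by rewrite cE xi0 rmorph0 mulr0 normr0 expr0n mulr0.
  by rewrite mulr_ge0 ?exprn_ge0 // /toC ler0c subr_ge0.
have sum0 : \sum_i toC (x i - lambda) * `|c 0 i| ^+ 2 = 0.
  apply/eqP; rewrite eq_le sumr_ge0 ?andbT //.
  under eq_bigr => i _ do rewrite rmorphB mulrBl.
  rewrite sumrB -energyE -mulr_sumr -normE -rmorphM -rmorphB.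
  by rewrite -(rmorph0 toC) /toC lecR subr_le0.
have cD : c *m diag_mx d = toC lambda *: c.
  apply/rowP => i; rewrite mul_mx_diag !mxE dE -/toC mulrC.
  move: (sum0) => /eqP; rewrite psumr_eq0 // => /allP/(_ i).
  rewrite mem_index_enum => /(_ isT); rewrite mulf_eq0 expf_eq0 normr_eq0 /=.
  by rewrite rmorphB subr_eq0 => /orP[/eqP->|/eqP->] //; rewrite !mulr0.
apply: (map_mx_inj (f := toC)).
by rewrite map_mxM map_mxZ -/vC -/AC vCE -mulmxA PAC mulmxA cD scalemxAl.
Qed.

(** * The quadratic form of a graph Laplacian *)

Section Laplacian.
Context (R : realType) (V : finType) (e : rel V).
Hypothesis sym_e : symmetric e.
Implicit Types (f g k : V -> R) (lambda : R).

(** Green's formula.  Each unordered edge is met in both orientations, whence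
    the factor 2 on the left. *)
Lemma green f g :
  (\sum_x laplacian e f x * g x) *+ 2
    = \sum_x \sum_(y | e x y) (f x - f y) * (g x - g y).
Proof.
pose S := \sum_x \sum_(y | e x y) (f x - f y) * g x.
have -> : \sum_x laplacian e f x * g x = S.
  by apply: eq_bigr => x _; rewrite /laplacian mulr_suml.
have SE : S = \sum_x \sum_(y | e x y) (f y - f x) * g y.
  rewrite {1}/S (exchange_big_dep predT) //=.
  by apply: eq_bigr => x _; apply: eq_bigl => y; rewrite sym_e.
rewrite mulr2n {2}SE /S -big_split /=; apply: eq_bigr => x _.
rewrite -big_split /=; apply: eq_bigr => y _.
by rewrite mulrBr -[f y - f x]opprB mulNr.
Qed.

Lemma laplacian_selfadjoint f g :
  \sum_x laplacian e f x * g x = \sum_x laplacian e g x * f x.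
Proof.
apply: (@mulIf R 2%:R); first by rewrite pnatr_eq0.
rewrite !mulr_natr !green; apply: eq_bigr => x _; apply: eq_bigr => y _.
exact: mulrC.
Qed.

Lemma sum_laplacian f : \sum_x laplacian e f x = 0.
Proof.
have /esym := laplacian_selfadjoint f (fun=> 1).
rewrite [LHS]big1 => [/esym|x _]; last first.
  by rewrite /laplacian big1 ?mul0r // => y _; rewrite subrr.
by under eq_bigr => x _ do rewrite mulr1.
Qed.

Lemma dirichlet_energy_ge0 f :
  0 <= \sum_x \sum_(y | e x y) (f x - f y) * (f x - f y).
Proof. by do 2!(apply: sumr_ge0 => ? _); rewrite -expr2 sqr_ge0. Qed.

Lemma graph_eigenvalue_ge0 (a : R) : graph_eigenvalue e a -> 0 <= a.
Proof.
case=> f [[x fx] Lf].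
have f2_gt0 : 0 < \sum_x f x ^+ 2.
  rewrite (bigD1 x) //= ltr_pwDl ?exprn_even_gt0 //.
  by apply: sumr_ge0 => y _; rewrite sqr_ge0.
rewrite -(pmulr_lge0 _ f2_gt0) mulr_sumr -(pmulrn_lge0 _ (n := 2)) //.
have -> : \sum_x a * f x ^+ 2 = \sum_x laplacian e f x * f x.
  by apply: eq_bigr => y _; rewrite Lf expr2 mulrA.
by rewrite green dirichlet_energy_ge0.
Qed.

(** By Green's formula the sum of the squares of the differences of a harmonic
    function along the edges is zero, so each difference is. *)
Lemma harmonic_constant k x y :
  (forall z, laplacian e k z = 0) -> connect e x y -> k x = k y.
Proof.
move=> Lk; have edge z t : e z t -> k z = k t.
  have := green k k; rewrite [in LHS]big1 => [|u _]; last by rewrite Lk mul0r.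
  move=> /esym/eqP; rewrite mul0rn psumr_eq0 => [/allP/(_ z)|u _]; last first.
    by apply: sumr_ge0 => v _; rewrite -expr2 sqr_ge0.
  rewrite mem_index_enum => /(_ isT) /=.
  rewrite psumr_eq0 => [/allP/(_ t)|v _]; last by rewrite -expr2 sqr_ge0.
  rewrite mem_index_enum => /(_ isT) /implyP h /h.
  by rewrite mulf_eq0 orbb subr_eq0 => /eqP.
case/connectP=> p; elim: p x => [x _ -> //|t p IH x /= /andP[xt pt] yE].
by rewrite (edge _ _ xt); exact: IH.
Qed.

Lemma laplacian_mx_sym : (@laplacian_mx R V e)^T = @laplacian_mx R V e.
Proof.
have E i j : @laplacian_mx R V e i j = \sum_x
    laplacian e (fun y => (y == enum_val i)%:R) x * (x == enum_val j)%:R.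
  rewrite mxE (bigD1 (enum_val j)) //= eqxx mulr1 big1 ?addr0 // => x.
  by move/negPf->; rewrite mulr0.
by apply/matrixP => i j; rewrite mxE !E laplacian_selfadjoint.
Qed.

(** The variational characterization of the smallest positive eigenvalue, for
    test functions orthogonal to all harmonic functions: on a disconnected graph
    orthogonality to the constants would not exclude the kernel. *)
Lemma rayleigh_minimizer lambda g :
  (forall b, graph_eigenvalue e b -> 0 < b -> lambda <= b) ->
  (forall k, (forall x, laplacian e k x = 0) -> \sum_x g x * k x = 0) ->
  \sum_x laplacian e g x * g x <= lambda * \sum_x g x ^+ 2 ->
  forall x, laplacian e g x = lambda * g x.
Proof.
move=> le_pos orth_ker ray_le.
have sumE (F : V -> R) : \sum_(i < #|V|) F (enum_val i) = \sum_x F x.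
  by rewrite [RHS](reindex _ (onW_bij _ (@enum_val_bij V))).
pose v : 'rV[R]_#|V| := \row_i g (enum_val i); pose L := @laplacian_mx R V e.
have vL : v *m L = \row_i laplacian e g (enum_val i).
  exact: mul_laplacian_mx.
suff /rowP vL_eq : v *m L = lambda *: v.
  by move=> x; have := vL_eq (enum_rank x); rewrite vL !mxE enum_rankK.
apply: rayleigh_minimizer_eigenvector; first exact: laplacian_mx_sym.
- move=> a /graph_eigenvalueE ea; have := graph_eigenvalue_ge0 ea.
  by rewrite le_eqVlt => /orP[/eqP<-|/(le_pos _ ea)]; [left|right].
(* Orthogonality to the kernel puts v in the row space of L: the columns of
   the cokernel of L are harmonic, L being symmetric. *)
- rewrite submxE; apply/eqP/rowP => j; rewrite [RHS]mxE.
  pose k x := cokermx L (enum_rank x) j.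
  have kE i : k (enum_val i) = cokermx L i j by rewrite /k enum_valK.
  have Lk x : laplacian e k x = 0.
    have /matrixP/(_ (enum_rank x) j) := mulmx_coker L.
    rewrite [RHS]mxE => <-.
    transitivity (((\row_i k (enum_val i)) *m L) 0 (enum_rank x)).
      by rewrite mul_laplacian_mx mxE enum_rankK.
    rewrite [LHS]mxE [RHS]mxE; apply: eq_bigr => i _.
    by rewrite -{1}[L]laplacian_mx_sym [_^T _ _]mxE mulrC [X in _ * X]mxE kE.
  rewrite -[RHS](orth_ker k Lk) -sumE mxE.
  by apply: eq_bigr => i _; rewrite kE mxE.
- rewrite vL !mxE.
  under eq_bigr => i _ do rewrite !mxE.
  under [in leRHS]eq_bigr => i _ do rewrite !mxE -expr2.
  by rewrite (sumE (fun x => laplacian e g x * g x))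
    (sumE (fun x => g x ^+ 2)).
Qed.

End Laplacian.

(** * Test functions supported on two parts of a graph *)

Section TwoParts.
Context (R : realType) (V : finType) (e : rel V) (lambda : R) (phi : V -> R).
Hypothesis sym_e : symmetric e.
Hypothesis Lphi : forall x, laplacian e phi x = lambda * phi x.

Let pos x := Num.max (phi x) 0.

(** Where phi x > 0 the factor c is the same at all neighbours of x, and
    replacing the values of phi there by their positive parts only decreases the
    Laplacian at x; elsewhere both sides are 0.  The sign of c does not matter,
    since c enters as a square. *)
Lemma positive_part_subsolution (c : V -> R) x :
  (forall y, e x y -> phi x != 0 -> c x = c y) ->
  laplacian e (fun y => c y * pos y) x * (c x * pos x)
    <= lambda * (c x * pos x) ^+ 2.
Proof.
move=> cxy; have [phix_le0|phix_gt0] := leP (phi x) 0.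
  by rewrite /pos (max_idPr phix_le0) !mulr0 expr0n mulr0.
have posx : pos x = phi x by apply/max_idPl/ltW.
have -> : lambda * (c x * pos x) ^+ 2
    = c x ^+ 2 * phi x * laplacian e phi x.
  by rewrite Lphi posx; ring.
rewrite /laplacian mulr_suml mulr_sumr; apply: ler_sum => y xy.
rewrite -(cxy _ xy) ?gt_eqF // posx -mulrBr.
have -> : c x * (phi x - pos y) * (c x * phi x)
    = c x ^+ 2 * phi x * (phi x - pos y).
  by ring.
apply: ler_wpM2l; first by rewrite mulr_ge0 ?sqr_ge0 // ltW.
by rewrite lerD2l lerN2 /pos le_max lexx.
Qed.

(** At a zero of an eigenfunction the values at the neighbours sum to zero. *)
Lemma eigenfunction_zero_spreads (g : V -> R) x :
  laplacian e g x = lambda * g x -> g x = 0 ->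
  (forall y, e x y -> 0 <= g y) -> forall y, e x y -> g y = 0.
Proof.
rewrite /laplacian => Lg gx0 g_ge0 y xy; move: Lg.
rewrite gx0 mulr0 (eq_bigr (fun y => - g y)) => [|z _]; last by rewrite sub0r.
move/eqP; rewrite sumrN oppr_eq0 psumr_eq0 // => /allP/(_ y).
by rewrite mem_index_enum => /(_ isT)/implyP/(_ xy)/eqP.
Qed.

(** If no eigenvalue lay strictly between 0 and lambda, the positive parts of
    phi on A and on B, weighted so that they cancel in the sum, would form an
    eigenvector g for lambda with g >= 0 on A.  In the application A and B are
    the vertex sets of two of the glued graphs.  The vertex z is a zero of phi
    in A from which the vertex a, with phi a > 0, can be reached inside A: the
    zeros of g spread along this path to a, where g is positive. *)
Lemma smaller_eigenvalue_of_two_parts (A B : {set V}) (z a b : V) :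
  [disjoint A & B] ->
  (forall x y, e x y -> (x \in A) != (y \in A) -> phi x = 0 /\ phi y = 0) ->
  (forall x y, e x y -> (x \in B) != (y \in B) -> phi x = 0 /\ phi y = 0) ->
  (forall x y, x \in A -> y \in B -> connect e x y) ->
  z \in A -> phi z = 0 -> connect [rel x y | e x y && (y \in A)] z a ->
  a \in A -> 0 < phi a -> b \in B -> 0 < phi b ->
  exists2 mu, graph_eigenvalue e mu & 0 < mu < lambda.
Proof.
move=> dAB cutA cutB connAB zA phiz za aA phia bB phib.
have [/hasP[mu /mem_spectrum emu mub]|/hasPn noteig] :=
    boolP (has (fun mu => 0 < mu < lambda) (@spectrum R V e)).
  by exists mu.
have pos_ge0 x : 0 <= pos x by rewrite /pos le_max lexx orbT.
have le_pos mu : graph_eigenvalue e mu -> 0 < mu -> lambda <= mu.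
  move=> /mem_spectrum/noteig; rewrite negb_and => /orP[/negPf->//|].
  by rewrite -leNgt.
have sum_pos_gt0 (C : {set V}) x :
    x \in C -> 0 < phi x -> 0 < \sum_(y in C) pos y.
  move=> xC phix; rewrite (bigD1 x) //= ltr_pwDl //.
    by rewrite /pos lt_max phix.
  by apply: sumr_ge0 => y _; exact: pos_ge0.
(* These weights make the A-part and the B-part of g cancel in the sum of g. *)
pose alpha := \sum_(y in B) pos y; pose beta := \sum_(y in A) pos y.
have alpha_gt0 : 0 < alpha by exact: sum_pos_gt0 bB phib.
pose c x := alpha * (x \in A)%:R - beta * (x \in B)%:R.
pose g x := c x * pos x.
have c_edge x y : e x y -> phi x != 0 -> c x = c y.
  move=> xy phix; have [EA|/(cutA _ _ xy)[/eqP]] := eqVneq (x \in A) (y \in A);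
    last by rewrite (negPf phix).
  have [EB|/(cutB _ _ xy)[/eqP]] := eqVneq (x \in B) (y \in B);
    last by rewrite (negPf phix).
  by rewrite /c EA EB.
have Lg x : laplacian e g x = lambda * g x.
  apply: rayleigh_minimizer => // [k Lk|].
    have kA x0 : x0 \in A -> k x0 = k b.
      by move=> x0A; apply: (harmonic_constant sym_e Lk); exact: connAB.
    have kB x0 : x0 \in B -> k x0 = k b.
      move=> x0B; rewrite -(kA _ aA); apply/esym.
      by apply: (harmonic_constant sym_e Lk); exact: connAB.
    have -> : \sum_y g y * k y = alpha * (\sum_(y in A) pos y * k y)
        - beta * (\sum_(y in B) pos y * k y).
      rewrite !mulr_sumr (big_mkcond (mem A)) (big_mkcond (mem B)) -sumrB /=.
      apply: eq_bigr => y _; rewrite /g /c !mulrBl.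
      by case: (y \in A); case: (y \in B);
        rewrite ?mulr1 ?mulr0 ?mul0r -?mulrA.
    have sumk (C : {set V}) : (forall y, y \in C -> k y = k b) ->
        \sum_(y in C) pos y * k y = (\sum_(y in C) pos y) * k b.
      by move=> kC; rewrite mulr_suml; apply: eq_bigr => y /kC->.
    by rewrite !sumk // -/alpha -/beta mulrCA subrr.
  rewrite mulr_sumr; apply: ler_sum => y _.
  by apply: positive_part_subsolution => t; exact: c_edge.
have gA x : x \in A -> g x = alpha * pos x.
  by move=> xA; rewrite /g /c xA (disjointFr dAB xA) mulr1 mulr0 subr0.
suff: phi a <= 0 by rewrite leNgt phia.
suff /eqP : g a = 0.
  rewrite gA // mulf_eq0 gt_eqF //= => /eqP <-.
  by rewrite /pos le_max lexx.
have : g z = 0 by rewrite /g /pos phiz maxxx mulr0.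
case/connectP: za => p; elim: p z zA {phiz} => [z _ _ -> //|y p IH z zA /=].
case/andP=> /andP[zy yA] py aE gz0; apply: (IH y) => //.
apply: eigenfunction_zero_spreads (Lg z) gz0 _ _ zy => t zt.
have [tA|tA] := boolP (t \in A).
  by rewrite gA // mulr_ge0 ?pos_ge0 // ltW.
have [|_ phit] := cutA _ _ zt; first by rewrite zA (negPf tA).
by rewrite /g /pos phit maxxx mulr0.
Qed.

End TwoParts.

(** An eigenvector for a nonzero eigenvalue sums to zero. *)
Lemma eigenvector_positive_value (R : realType) (V : finType) (e : rel V)
    (lambda : R) (f : V -> R) :
  symmetric e -> 0 < lambda -> eigenvector e lambda f -> exists x, 0 < f x.
Proof.
move=> sym_e lambda_gt0 [[x fx] Lf]; apply/existsP; apply: contraNT fx.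
move=> /existsPn f_le0.
have /eqP : \sum_y f y = 0.
  have /eqP := sum_laplacian sym_e f.
  under eq_bigr => y _ do rewrite Lf.
  by rewrite -mulr_sumr mulf_eq0 gt_eqF //= => /eqP.
rewrite -oppr_eq0 -sumrN psumr_eq0 => [/allP/(_ x)|y _].
  by rewrite mem_index_enum oppr_eq0; exact.
by rewrite oppr_ge0 leNgt.
Qed.

(** In the sorted list the entries 0 and mu occupy distinct positions, so one of
    them occurs at index at least 1. *)
Lemma spectrum1_lt (R : realType) (V : finType) (e : rel V) (lambda mu : R) :
  graph_eigenvalue e (0 : R) -> graph_eigenvalue e mu -> 0 < mu < lambda ->
  (@spectrum R V e)`_1 < lambda.
Proof.
move=> /mem_spectrum s0 /mem_spectrum smu /andP[mu_gt0 mu_lt].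
apply: le_lt_trans mu_lt; set s := @spectrum R V e in s0 smu *.
have nth_mono i j : (i <= j)%N -> (j < size s)%N -> s`_i <= s`_j.
  by move=> ij js; apply: (sorted_leq_nth le_trans le_refl 0
    (@spectrum_sorted R V e)); rewrite ?inE // (leq_ltn_trans ij).
have [i0|i0] := leqP 1 (index 0 s).
  by apply: le_trans (ltW mu_gt0); rewrite -[leRHS](nth_index 0 s0)
    nth_mono ?index_mem.
rewrite -[leRHS](nth_index 0 smu) nth_mono ?index_mem // lt0n.
apply: contraTneq mu_gt0 => imu0.
rewrite -(nth_index 0 smu) imu0.
by move: i0; rewrite ltnS leqn0 => /eqP <-; rewrite nth_index // ltxx.
Qed.

(** * Gluing graphs along zeros of eigenvectors *)

Section JoinGraph.
Context (R : realType) (n : nat) (V : 'I_n -> finType).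
Context (e : forall j, rel (V j)) (phi : forall j, V j -> R).
Context (E0 : {set {j : 'I_n & V j} * {j : 'I_n & V j}}).
Hypothesis E0_zeros : forall x y : {j : 'I_n & V j}, (x, y) \in E0 ->
  [/\ tag x != tag y,
      tagged x \in zero_set (@phi (tag x))
    & tagged y \in zero_set (@phi (tag y))].

Local Notation G := (join_graph (@e) E0).
Local Notation Phi := (join_fun (@phi)).

Lemma join_graph_cross u v :
  G u v -> tag u != tag v -> Phi u = 0 /\ Phi v = 0.
Proof.
rewrite /join_graph /join_fun => /orP[/andP[-> //]|/orP[]/E0_zeros[_]];
  by rewrite !inE => /eqP-> /eqP->.
Qed.

Lemma join_graph_same j (x y : V j) :
  G (Tagged V x) (Tagged V y) = e x y.
Proof.
rewrite /join_graph /= eqxx tagged_asE /=.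
by case: (e x y) => //=; apply/orP => -[]/E0_zeros[]/=; rewrite eqxx.
Qed.

(** Only edges between zeros leave a part, and these contribute 0 - 0. *)
Lemma laplacian_join u :
  laplacian G Phi u = laplacian (@e (tag u)) (@phi (tag u)) (tagged u).
Proof.
case: u => j x; rewrite /laplacian /= (bigID (fun v => tag v == j)) /=.
rewrite [X in _ + X]big1 ?addr0 => [|v /andP[uv]]; last first.
  rewrite eq_sym => /(join_graph_cross uv)[-> ->]; exact: subrr.
rewrite (reindex_onto (fun y => Tagged V y) (tagged_as (Tagged V x))) /=.
  apply: eq_bigl => y; rewrite eqxx tagged_asE eqxx !andbT.
  exact: join_graph_same.
by case=> l y /andP[_ /= /eqP lj]; case: _ / lj x y => x y; rewrite tagged_asE.
Qed.

(** The connecting path stays inside part j, as required for propagating zeros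
    within that part. *)
Lemma connect_join j (x y : V j) : connect (@e j) x y ->
  connect [rel u v | G u v && (v \in [set w | tag w == j])]
    (Tagged V x) (Tagged V y).
Proof.
case/connectP=> p; elim: p x => [x _ -> //|z p IH x /= /andP[xz pz] yE].
apply: connect_trans (IH _ pz yE); apply: connect1.
by rewrite /= join_graph_same xz inE eqxx.
Qed.

End JoinGraph.

Theorem theorem3p14 (R : realType) (n : nat) (V : 'I_n -> finType)
    (e : forall j : 'I_n, rel (V j)) (lambda : R)
    (phi : forall j : 'I_n, V j -> R)
    (E0 : {set {j : 'I_n & V j} * {j : 'I_n & V j}}) :
  (2 <= n)%N ->
  (forall j, simple_graph (e j)) ->
  (forall j, connected_graph (e j)) ->
  0 < lambda ->
  (forall j, eigenvector (e j) lambda (phi j)) ->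
  (forall j, zero_set (phi j) != set0) ->
  E0 != set0 ->
  (forall x y : {j : 'I_n & V j}, (x, y) \in E0 ->
     [/\ tag x != tag y,
         tagged x \in zero_set (phi (tag x))
       & tagged y \in zero_set (phi (tag y))]) ->
  let G := join_graph e E0 in
  (graph_eigenvalue G lambda /\ eigenvector G lambda (join_fun phi))
  /\ ((forall j, smallest_positive_eigenvalue (e j) lambda) ->
      [/\ graph_eigenvalue G lambda,
          ~ smallest_positive_eigenvalue G lambda,
          eigenvector G lambda (join_fun phi)
        & ~ fiedler_vector G (join_fun phi)]).
Proof.
move=> _ simple_e conn_e lambda_gt0 eig_phi zero_phi E0_n0 E0_zeros G.
pose Phi := join_fun phi.
have sym_G : symmetric G.
  by apply: proj1; apply: join_graph_simple simple_e _ => x y /E0_zeros[].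
have [[x y] xyE0] := set0Pn _ E0_n0.
have LPhi u : laplacian G Phi u = lambda * Phi u.
  by rewrite laplacian_join // (eig_phi _).2.
have eigPhi : eigenvector G lambda Phi.
  split=> //; have [[p phip] _] := eig_phi (tag x).
  by exists (Tagged V p).
have eigG : graph_eigenvalue G lambda by exists Phi.
split=> // _.
have zero_eig : graph_eigenvalue G (0 : R).
  exists (fun=> 1); split=> [|u]; first by exists x; rewrite oner_eq0.
  by rewrite mul0r /laplacian big1 // => v _; rewrite subrr.
pose A j : {set {j : 'I_n & V j}} := [set u | tag u == j].
have cut j u v : G u v -> (u \in A j) != (v \in A j) -> Phi u = 0 /\ Phi v = 0.
  move=> uv; rewrite !inE => tuv; apply: (join_graph_cross E0_zeros uv).
  by apply: contraNneq tuv => ->.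
have connA u v : tag u = tag v -> connect G u v.
  case: u v => j s [l t] /= jl; case: _ / jl t => t.
  apply: connect_sub (connect_join E0_zeros (conn_e j s t)) => u v /=.
  by case/andP=> uv _; exact: connect1.
have [mu emu mu_bd] : exists2 mu, graph_eigenvalue G mu & 0 < mu < lambda.
  have positive j := eigenvector_positive_value (simple_e j).1 lambda_gt0
    (eig_phi j).
  have [a phia] := positive (tag x); have [b phib] := positive (tag y).
  have [z] := set0Pn _ (zero_phi (tag x)); rewrite inE => /eqP phiz.
  have [txy _ _] := E0_zeros _ _ xyE0.
  apply: (smaller_eigenvalue_of_two_parts sym_G LPhi (A := A (tag x))
    (B := A (tag y)) (z := Tagged V z) (a := Tagged V a) (b := Tagged V b));
    rewrite ?inE ?eqxx //.
  - by apply/pred0P => u; rewrite /= !inE; case: eqP => // ->; exact/negbTE.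
  - exact: cut.
  - exact: cut.
  - move=> u v; rewrite !inE => /eqP tu /eqP tv.
    apply: connect_trans (connA _ _ tu) (connect_trans _ (connA _ _ (esym tv))).
    by apply: connect1; rewrite /G /join_graph xyE0 orbT.
  - by have := connect_join E0_zeros (conn_e (tag x) z a).
split=> // [[_ _ /(_ mu emu)]|[_ LPhi1]].
  by case/andP: mu_bd => mu_gt0 mu_lt /(_ mu_gt0); rewrite leNgt mu_lt.
have [[u phiu] _] := eigPhi.
have /mulIf/(_ _ _ (etrans (esym (LPhi1 u)) (LPhi u))) E := phiu.
by have := spectrum1_lt zero_eig emu mu_bd; rewrite E ltxx.
Qed.
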